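(* Let $G$ be any group and let $H\le G$ be any Cohen–Lyndon subgroup of $G$. Let $\langle\langle H\rangle\rangle$ denote the normal closure of $H$ in $G$. Then the subgroup $\langle S\rangle$ of $G$ generated by the set $$S=\{[h_1^{g_1},h_2^{g_2}]\mid h_1,h_2\in H,\ g_1,g_2\in G,\ g_1\langle\langle H\rangle\rangle\ne g_2\langle\langle H\rangle\rangle\}$$ is normal in $G$, and $G/\langle S\rangle\in\mathcal{WR}(H,G/\langle\langle H\rangle\rangle)$.
   Context: Notation: $x^y=yxy^{-1}$ and $[x,y]$ is the commutator of $x$ and $y$. A left transversal of a subgroup $K$ in $G$ is a subset of $G$ containing exactly one element of each left coset of $K$. A subgroup $H$ of $G$ is a Cohen–Lyndon subgroup of $G$ if there is a left transversal $T$ of $\langle\langle H\rangle\rangle$ in $G$ such that $\langle\langle H\rangle\rangle$ is the free product of its subgroups $tHt^{-1}$, $t\in T$ (i.e. $\langle\langle H\rangle\rangle=\ast_{t\in T}tHt^{-1}$). Wreath-like products: for groups $A,B$, a set $I$ and a left action $B\curvearrowright I$, $\mathcal{WR}(A,B\curvearrowright I)$ is the set of groups $W$ that are extensions $1\to\bigoplus_{i\in I}A_i\to W\xrightarrow{\varepsilon}B\to1$ with $A_i\cong A$ for all $i$ and $wA_iw^{-1}=A_{\varepsilon(w)i}$ for all $w\in W$, $i\in I$. If the action $B\curvearrowright I$ is regular (free and transitive), the wreath-like product is called regular; $\mathcal{WR}(A,B)$ is the set of all regular wreath-like products of $A$ and $B$. *)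

(* Defs.v *)
From HB Require Import structures.
From mathcomp Require Import all_boot.
From mathcomp Require Import boolp classical_sets cardinality.

Set Implicit Arguments.
Unset Strict Implicit.
Unset Printing Implicit Defensive.

Local Open Scope classical_set_scope.
Local Open Scope group_scope.

Section Subgroups.
Variable G : groupType.
Implicit Types (K N X T : set G) (x y g t : G).

Definition subgroup K : Prop :=
  [/\ K 1, forall x y, K x -> K y -> K (x * y) & forall x, K x -> K x^-1].

(* The convention x^y = y x y^-1; the library's x ^ y is y^-1 * (x * y). *)
Definition lconj x g : G := g * x * g^-1.

Definition lconj_set K g : set G := [set lconj x g | x in K].

Definition normal_subgroup N : Prop :=
  subgroup N /\ forall g x, N x -> N (lconj x g).

Definition generated X : set G := smallest subgroup X.

Definition normal_closure X : set G := smallest normal_subgroup X.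

Definition lcoset K g : set G := [set g * x | x in K].

Definition left_transversal K T : Prop :=
  forall g, exists! t, T t /\ lcoset K g t.

(* P is the internal free product (coproduct in the category of groups) of its
   subgroups K t, t in T.  A homomorphism defined on a subgroup is represented
   by a function on G, only its values on that subgroup being relevant. *)
Definition free_product_of T (K : G -> set G) (P : set G) : Prop :=
  [/\ subgroup P,
      forall t, T t -> subgroup (K t) /\ K t `<=` P
    & forall (L : groupType) (f : G -> G -> L),
        (forall t, T t ->
          forall x y, K t x -> K t y -> f t (x * y) = f t x * f t y) ->
        (exists phi : G -> L,
          (forall x y, P x -> P y -> phi (x * y) = phi x * phi y) /\
          (forall t, T t -> forall x, K t x -> phi x = f t x)) /\
        (forall phi psi : G -> L,
          (forall x y, P x -> P y -> phi (x * y) = phi x * phi y) ->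
          (forall x y, P x -> P y -> psi (x * y) = psi x * psi y) ->
          (forall t, T t -> forall x, K t x -> phi x = f t x) ->
          (forall t, T t -> forall x, K t x -> psi x = f t x) ->
          forall x, P x -> phi x = psi x)].

Definition Cohen_Lyndon_subgroup (H : set G) : Prop :=
  subgroup H /\
  exists T : set G, left_transversal (normal_closure H) T /\
    free_product_of T (lconj_set H) (normal_closure H).

(* [~ x, y] is x^-1 * y^-1 * x * y.  As H is closed under inversion, the other
   convention x * y * x^-1 * y^-1 yields the same set. *)
Definition coset_commutators (H : set G) : set G :=
  [set s | exists h1 h2 g1 g2,
     [/\ H h1, H h2,
         lcoset (normal_closure H) g1 <> lcoset (normal_closure H) g2
       & s = [~ lconj h1 g1, lconj h2 g2]]].

Lemma subgroup_closed K : subgroup K -> group_closed (mem K).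
Proof.
case=> K1 KM KV; split=> [|x y]; first exact: mem_set.
move=> /set_mem Kx /set_mem Ky.
by apply: mem_set; apply: KM => //; apply: KV.
Qed.

Lemma normal_closure_normal X : normal_subgroup (normal_closure X).
Proof.
split; first split.
- by move=> N [[[]]].
- move=> x y Xx Xy N XN; have [[[_ NM _] _] _] := XN.
  by apply: NM; [apply: Xx | apply: Xy].
- move=> x Xx N XN; have [[[_ _ NV] _] _] := XN.
  by apply: NV; apply: Xx.
- by move=> g x Xx N XN; have [[_ NJ] _] := XN; apply: NJ; apply: Xx.
Qed.

End Subgroups.

(* A subgroup K of G as a group. *)
Definition subgroup_group (G : groupType) (K : set G) (sK : subgroup K) : Type :=
  set_type K.

HB.instance Definition _ (G : groupType) (K : set G) (sK : subgroup K) :=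
  SubChoice.on (subgroup_group sK).
HB.instance Definition _ (G : groupType) (K : set G) (sK : subgroup K) :=
  SubChoice_isSubGroup.Build G (mem K) (subgroup_group sK) (subgroup_closed sK).

Section Quotient.
Variables (G : groupType) (N : set G).

Definition same_lcoset : rel G := fun x y => `[< lcoset N x = lcoset N y >].

Lemma same_lcoset_equiv : equiv_class_of same_lcoset.
Proof.
split=> [x|x y|y x z]; first exact/asboolP.
- by apply/asboolP/asboolP.
- by move=> /asboolP xy /asboolP yz; apply/asboolP; rewrite xy.
Qed.

Canonical same_lcoset_equiv_rel := EquivRelPack same_lcoset_equiv.

Definition quotient_group (nN : normal_subgroup N) : Type :=
  {eq_quot same_lcoset}%qT.

Variable nN : normal_subgroup N.
Notation GN := (quotient_group nN).
HB.instance Definition _ := Choice.on GN.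
HB.instance Definition _ := EqQuotient.on GN.

Local Open Scope quotient_scope.

Definition quot_one : GN := \pi_GN 1.
Definition quot_mul (a b : GN) : GN := \pi_GN (repr a * repr b).
Definition quot_inv (a : GN) : GN := \pi_GN (repr a)^-1.

Lemma lcosetP x y : reflect (N (x^-1 * y)) (\pi_GN x == \pi_GN y).
Proof.
have [[[N1 NM NV] NJ] e] := (nN, eqmodE same_lcoset_equiv_rel x y).
rewrite [_ == _]e; apply: (iffP (asboolP _)) => [exy | Nxy].
  have: lcoset N y y by exists 1; rewrite ?mulg1.
  by rewrite -exy => -[z Nz <-]; rewrite mulKg.
apply/seteqP; split=> _ [z Nz <-].
  exists ((x^-1 * y)^-1 * z); first by apply: NM => //; apply: NV.
  by rewrite invgM invgK !mulgA mulgV mul1g.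
by exists (x^-1 * y * z); [apply: NM | rewrite !mulgA mulgV mul1g].
Qed.

Lemma quot_mulE x y : quot_mul (\pi_GN x) (\pi_GN y) = \pi_GN (x * y).
Proof.
have [[N1 NM NV] NJ] := nN; apply/eqP/lcosetP.
have /lcosetP Nx : \pi_GN (repr (\pi_GN x)) == \pi_GN x by rewrite reprK.
have /lcosetP Ny : \pi_GN (repr (\pi_GN y)) == \pi_GN y by rewrite reprK.
move: (repr (\pi_GN x)) (repr (\pi_GN y)) Nx Ny => x' y' Nx Ny.
have := NM _ _ (NJ y'^-1 _ Nx) Ny.
rewrite /lconj invgM invgK !mulgA. by rewrite mulgK.
Qed.

Lemma quot_invE x : quot_inv (\pi_GN x) = \pi_GN x^-1.
Proof.
have [[N1 NM NV] NJ] := nN; apply/eqP/lcosetP.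
have /lcosetP Nx : \pi_GN (repr (\pi_GN x)) == \pi_GN x by rewrite reprK.
move: (repr _) Nx => x' Nx.
have := NJ x' _ (NV _ Nx).
by rewrite /lconj invgM !invgK !mulgA mulgK.
Qed.

Lemma quot_mulA : associative quot_mul.
Proof.
move=> a b c; rewrite -[a]reprK -[b]reprK -[c]reprK.
move: (repr a) (repr b) (repr c) => x y z.
by rewrite (quot_mulE y z) (quot_mulE x y) !quot_mulE mulgA.
Qed.

Lemma quot_mul1g : left_id quot_one quot_mul.
Proof. by move=> a; rewrite -[a]reprK quot_mulE mul1g. Qed.

Lemma quot_mulg1 : right_id quot_one quot_mul.
Proof. by move=> a; rewrite -[a]reprK quot_mulE mulg1. Qed.

Lemma quot_mulVg : left_inverse quot_one quot_inv quot_mul.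
Proof. by move=> a; rewrite -[a]reprK quot_invE quot_mulE mulVg. Qed.

Lemma quot_mulgV : right_inverse quot_one quot_inv quot_mul.
Proof. by move=> a; rewrite -[a]reprK quot_invE quot_mulE mulgV. Qed.

HB.instance Definition _ := isGroup.Build GN
  quot_mulA quot_mul1g quot_mulg1 quot_mulVg quot_mulgV.

End Quotient.

(* The external direct sum (restricted product) of a family of groups. *)
Record dsum (I : Type) (A_ : I -> groupType) := DSum {
  dsum_fun :> forall i, A_ i;
  dsum_finite : finite_set [set i | dsum_fun i <> 1]
}.

Section DirectSum.
Variables (I : Type) (A_ : I -> groupType).
Implicit Types u v w : dsum A_.

HB.instance Definition _ := gen_eqMixin (dsum A_).
HB.instance Definition _ := gen_choiceMixin (dsum A_).

Lemma dsumP u v : (forall i, u i = v i) -> u = v.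
Proof.
case: u v => [u fu] [v fv] /= uv.
have euv : u = v by apply: functional_extensionality_dep.
by rewrite euv in fu *; congr DSum; apply: Prop_irrelevance.
Qed.

Lemma dsum1_finite : finite_set [set i | (1 : A_ i) <> 1].
Proof. by apply: (sub_finite_set _ (finite_set0 I)) => i []. Qed.

Lemma dsumM_finite u v : finite_set [set i | u i * v i <> 1].
Proof.
have fuv : finite_set ([set i | u i <> 1] `|` [set i | v i <> 1]).
  by rewrite finite_setU; split; apply: dsum_finite.
apply: (sub_finite_set _ fuv) => i /= uv1.
by apply/not_andP => -[ui vi]; apply: uv1; rewrite ui vi mulg1.
Qed.

Lemma dsumV_finite u : finite_set [set i | (u i)^-1 <> 1].
Proof.
apply: (sub_finite_set _ (dsum_finite u)) => i /= ui1 ui.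
by apply: ui1; rewrite ui invg1.
Qed.

Definition dsum_one : dsum A_ := DSum dsum1_finite.
Definition dsum_mul u v : dsum A_ := DSum (dsumM_finite u v).
Definition dsum_inv u : dsum A_ := DSum (dsumV_finite u).

Lemma dsum_mulA : associative dsum_mul.
Proof. by move=> u v w; apply: dsumP => i /=; rewrite mulgA. Qed.

Lemma dsum_mul1g : left_id dsum_one dsum_mul.
Proof. by move=> u; apply: dsumP => i /=; rewrite mul1g. Qed.

Lemma dsum_mulg1 : right_id dsum_one dsum_mul.
Proof. by move=> u; apply: dsumP => i /=; rewrite mulg1. Qed.

Lemma dsum_mulVg : left_inverse dsum_one dsum_inv dsum_mul.
Proof. by move=> u; apply: dsumP => i /=; rewrite mulVg. Qed.

Lemma dsum_mulgV : right_inverse dsum_one dsum_inv dsum_mul.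
Proof. by move=> u; apply: dsumP => i /=; rewrite mulgV. Qed.

HB.instance Definition _ := isGroup.Build (dsum A_)
  dsum_mulA dsum_mul1g dsum_mulg1 dsum_mulVg dsum_mulgV.

(* The i-th summand, as a subgroup of the direct sum. *)
Definition dsum_component (i : I) : set (dsum A_) :=
  [set u | forall j, j <> i -> u j = 1].

End DirectSum.

Definition isomorphic_groups (A B : groupType) : Prop :=
  exists f : {multiplicative A -> B}, bijective f.

Definition left_action (B : groupType) (I : Type) (act : B -> I -> I) : Prop :=
  (forall i, act 1 i = i) /\ (forall b c i, act (b * c) i = act b (act c i)).

Definition regular_action (B : groupType) (I : Type) (act : B -> I -> I) : Prop :=
  [/\ left_action act,
      forall b i, act b i = i -> b = 1,
      inhabited I
    & forall i j, exists b, act b i = j].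

Definition short_exact (K W B : groupType)
    (iota : {multiplicative K -> W}) (eps : {multiplicative W -> B}) : Prop :=
  [/\ injective iota, range iota = eps @^-1` [set 1] & range eps = [set: B]].

(* W belongs to WR(A, B acting on I).  The subgroup A_i of W is the image under
   iota of the i-th component of the direct sum. *)
Definition wreath_like (A B : groupType) (I : Type) (act : B -> I -> I)
    (W : groupType) : Prop :=
  exists (A_ : I -> groupType) (iota : {multiplicative dsum A_ -> W})
         (eps : {multiplicative W -> B}),
    [/\ short_exact iota eps,
        forall i, isomorphic_groups (A_ i) A
      & forall (w : W) (i : I),
          lconj_set (iota @` dsum_component i) w
          = iota @` dsum_component (act (eps w) i)].

(* W belongs to WR(A, B). *)
Definition regular_wreath_like (A B W : groupType) : Prop :=
  exists (I : Type) (act : B -> I -> I),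
    regular_action act /\ wreath_like A act W.

(* Main.v *)
From HB Require Import structures.
Require Import Defs.
From mathcomp Require Import all_boot.
From mathcomp Require Import boolp classical_sets cardinality.

Set Implicit Arguments.
Unset Strict Implicit.
Unset Printing Implicit Defensive.

(** Write N for the normal closure of H, S for the set of commutators, B = G/N
    and W = G/<S>.  Conjugation by G permutes the cosets of N, so it preserves S
    and <S> is normal.  Everything else follows from the isomorphism between
    N/<S> and the direct sum D of copies of H indexed by B.

    Since N is the free product of the t H t^-1, the maps sending t h t^-1 to
    the element of D with the single entry h at the coset tN extend to a
    homomorphism phi : N -> D (component_hom).  For arbitrary g, phi maps
    g H g^-1 into the component of index gN (phi_lconj_component), because g
    differs from the representative of gN by a left factor in N.  As distinct
    components commute, phi kills S.

    Conversely, N is generated by the t H t^-1 (free_product_generated), and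
    modulo <S> the subgroups t H t^-1 with distinct t commute.  Hence any
    element of N is congruent to a product of elements of t H t^-1, each t
    occurring at most once (closure_oprod_mod).  On such a product phi reads off
    the factors, so the kernel of phi is exactly <S> (phi_ker).  The same
    products show that phi is onto: an element u of D is the image of the product
    lift u over the support of u.

    The embedding D -> W is therefore u |-> lift u mod <S>, with image N/<S>, the
    kernel of W -> B.  It sends the component of index b to the image of
    t H t^-1, where t represents b, and conjugation by g maps that image onto the
    component of index gtN by phi_lconj_component.  Thus W permutes the
    components as B acts on itself by left multiplication, a regular action. *)

Local Open Scope classical_set_scope.
Local Open Scope group_scope.

(** * Conjugation and generated subgroups *)

Section Conjugation.
Variable G : groupType.
Implicit Types (x y g h : G) (X N : set G).

Lemma lconjM g x y : lconj (x * y) g = lconj x g * lconj y g.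
Proof. by rewrite /lconj !mulgA mulgVK. Qed.

Lemma lconjA g h x : lconj (lconj x h) g = lconj x (g * h).
Proof. by rewrite /lconj invgM !mulgA. Qed.

Lemma lconjV g x : lconj x^-1 g = (lconj x g)^-1.
Proof. by rewrite /lconj !invgM invgK !mulgA. Qed.

Lemma lconjR g x y : lconj [~ x, y] g = [~ lconj x g, lconj y g].
Proof. by rewrite !commgEl !conjgE !lconjM !lconjV. Qed.

Lemma lconjK g : cancel (fun x => lconj x g^-1) (fun x => lconj x g).
Proof. by move=> x; rewrite lconjA /lconj mulgV mul1g invg1 mulg1. Qed.

Lemma sub_generated X : X `<=` generated X.
Proof. by move=> x Xx K [_ XK]; apply: XK. Qed.

Lemma generated_sub X K : subgroup K -> X `<=` K -> generated X `<=` K.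
Proof. by move=> sK XK x; apply; split. Qed.

Lemma generated_subgroup X : subgroup (generated X).
Proof.
split=> [|x y Xx Xy|x Xx] K [sK XK]; have [K1 KM KV] := sK => //.
- by apply: KM; [apply: Xx | apply: Xy].
- by apply: KV; apply: Xx.
Qed.

Lemma generated_normal X :
  (forall g x, X x -> X (lconj x g)) -> normal_subgroup (generated X).
Proof.
move=> XJ; split=> [|g x]; first exact: generated_subgroup.
have [K1 KM KV] := generated_subgroup X.
apply: (@generated_sub _ [set x | generated X (lconj x g)]) => [|y Xy /=].
  split=> [|y z Xy Xz|y Xy] /=.
  - by rewrite /lconj mulg1 mulgV; apply: K1.
  - by rewrite lconjM; apply: KM.
  - by rewrite lconjV; apply: KV.
by apply: sub_generated; apply: XJ.
Qed.

(** The least subgroup is reached by left multiplications alone: the elements x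
    such that x and its inverse both preserve R form a subgroup. *)
Lemma generated_left_ind X (R : set G) :
  (forall x, X x -> X x^-1) -> R 1 ->
  (forall x r, X x -> R r -> R (x * r)) -> generated X `<=` R.
Proof.
move=> XV R1 XR x Xx.
pose K := [set x : G | forall r, R r -> R (x * r) /\ R (x^-1 * r)].
suff /(_ _ R1)[] : K x by rewrite mulg1.
apply: generated_sub x Xx => [|x Xx r Rr]; last by split; apply: XR; auto.
split=> [r Rr|x y Kx Ky r Rr|x Kx r Rr].
- by rewrite invg1 !mul1g.
- rewrite invgM -!mulgA; split.
    by have [/Kx[]] := Ky r Rr.
  by have [_ /Ky[]] := Kx r Rr.
- by rewrite invgK; have [] := Kx r Rr.
Qed.

Lemma normal_closure_sub X : X `<=` normal_closure X.
Proof. by move=> x Xx K [_ XK]; apply: XK. Qed.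

End Conjugation.

Definition multiplicative_of (G L : groupType) (f : G -> L)
    (fM : {morph f : x y / x * y}) : {multiplicative G -> L} :=
  HB.pack f (isMultiplicative.Build G L f fM).

(** * The projection onto a quotient group *)

Section Projection.
Variables (G : groupType) (N : set G) (nN : normal_subgroup N).

Definition proj (x : G) : quotient_group nN := (\pi x)%qT.

Lemma projM : {morph proj : x y / x * y}.
Proof. by move=> x y; apply/esym/quot_mulE. Qed.

Lemma projV : {morph proj : x / x^-1}.
Proof. by move=> x; apply/esym/quot_invE. Qed.

Lemma proj1 : proj 1 = 1.
Proof. by []. Qed.

Lemma projJ g x : proj (lconj x g) = lconj (proj x) (proj g).
Proof. by rewrite /lconj !projM projV. Qed.

Lemma proj_surj b : exists x, proj x = b.
Proof. by exists (repr b); apply: reprK. Qed.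

Lemma proj_eqP x y : proj x = proj y <-> N (x^-1 * y).
Proof. split=> [xy|/(lcosetP nN x y)/eqP//].
by apply/(lcosetP nN x y)/eqP. Qed.

Lemma proj_eq1P x : proj x = 1 <-> N x.
Proof.
have e1 : 1^-1 * x = x by rewrite invg1 mul1g.
by rewrite -{2}e1 -proj_eqP proj1; split=> /esym.
Qed.

Lemma proj_lcosetP x y : proj x = proj y <-> lcoset N x = lcoset N y.
Proof.
split=> [/eqP|xy]; first by rewrite eqmodE => /asboolP.
by apply/eqP; rewrite eqmodE; apply/asboolP.
Qed.

End Projection.

(** * Ordered products of commuting subgroups *)

Section OrderedProducts.
Variables (I : eqType) (A W : groupType) (e : I -> A -> W).
Hypothesis eM : forall i, {morph e i : a b / a * b}.
Hypothesis eC : forall i j a b, i != j -> commute (e i a) (e j b).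

Definition oprod (s : seq I) (h : I -> A) : W := \big[*%g/1]_(i <- s) e i (h i).

Definition update (h : I -> A) i a : I -> A := fun j => if j == i then a else h j.

Lemma oprod_update s h i a : i \notin s -> oprod s (update h i a) = oprod s h.
Proof.
move=> iNs; rewrite /oprod !big_seq; apply: eq_bigr => j js.
by rewrite /update; case: eqP js iNs => // -> ->.
Qed.

(** A factor is either prepended, when its index is new, or moved by
    commutation to the unique place that its index occupies. *)
Lemma mul_oprod s h i a : uniq s ->
  exists s' h', uniq s' /\ e i a * oprod s h = oprod s' h'.
Proof.
have [iS|iNs] := boolP (i \in s); last first.
  exists (i :: s), (update h i a); split; first by rewrite /= iNs.
  by rewrite {2}/oprod big_cons -/(oprod s _) oprod_update // /update eqxx.
exists s, (update h i (a * h i)); split=> //.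
elim: s iS H => [//|j s IHs] + /= /andP[jNs us].
rewrite inE /oprod !big_cons -!/(oprod s _).
have [-> _|ij /= iS] := eqVneq i j.
  by rewrite oprod_update // /update eqxx eM mulgA.
rewrite -IHs // {1}/update eq_sym (negPf ij) !mulgA.
by rewrite (eC a (h j) ij).
Qed.

End OrderedProducts.

Section ConstantDirectSum.
Variables (I : eqType) (A : groupType).
Notation D := (dsum (fun _ : I => A)).

Lemma dsum_at_finite i (a : A) :
  finite_set [set j : I | (if j == i then a else 1) <> 1].
Proof. by apply: sub_finite_set (finite_set1 i) => j /=; case: eqP. Qed.

Definition dsum_at i a : D := DSum (dsum_at_finite i a).

Lemma dsum_atM i : {morph dsum_at i : a b / a * b}.
Proof.
by move=> a b; apply: dsumP => j /=; case: eqP => // _; rewrite mulg1.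
Qed.

Lemma dsum_at_component i a : dsum_component i (dsum_at i a).
Proof. by move=> j /= /eqP/negPf->. Qed.

Lemma dsum_componentE i (u : D) : dsum_component i u -> u = dsum_at i (u i).
Proof. by move=> ui; apply: dsumP => j /=; case: eqP => [->|/ui]. Qed.

Lemma dsum_component_conj i (u v : D) :
  dsum_component i v -> dsum_component i (lconj v u).
Proof. by move=> vi j /vi /= ->; rewrite mulg1 mulgV. Qed.

Lemma dsum_component_commute i j (u v : D) : i <> j ->
  dsum_component i u -> dsum_component j v -> commute u v.
Proof.
move=> ij ui vj; apply: dsumP => k /=.
have [ki|/eqP/ui->] := eqVneq k i; last by rewrite mul1g mulg1.
by rewrite vj ?mulg1 ?mul1g // ki.
Qed.

Lemma oprod_dsum_at s h j : uniq s ->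
  oprod dsum_at s h j = if j \in s then h j else 1.
Proof.
elim: s => [|i s IHs] /=; first by rewrite /oprod big_nil.
move=> /andP[iNs us]; rewrite /oprod big_cons -/(oprod _ _ _) /= IHs // inE.
case: eqP => [->|_] /=; last by rewrite mul1g.
by rewrite (negPf iNs) mulg1.
Qed.

Definition dsupport (u : D) : seq I :=
  undup (projT1 (cid (iffLR (finite_seqP _) (dsum_finite u)))).

Lemma dsupport_uniq u : uniq (dsupport u).
Proof. exact: undup_uniq. Qed.

Lemma dsupportP u i : i \notin dsupport u -> u i = 1.
Proof.
rewrite /dsupport mem_undup; case: cid => s /= us iNs.
apply: contrapT => ui1; move/negP: iNs; apply.
by have : [set j | u j <> 1] i by []; rewrite us.
Qed.

Lemma oprod_dsupport u : oprod dsum_at (dsupport u) u = u.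
Proof.
apply: dsumP => i; rewrite oprod_dsum_at ?dsupport_uniq //.
by case: ifPn => // /dsupportP.
Qed.

End ConstantDirectSum.

(** * Free products *)

(** A free product is generated by its factors: if a subgroup Q contains them,
    the universal property yields a homomorphism into Q that restricts to the
    identity on each factor, and uniqueness makes it the identity. *)
Lemma free_product_generated (G : groupType) (T : set G) (K : G -> set G) P Q :
  free_product_of T K P -> subgroup Q -> (forall t, T t -> K t `<=` Q) ->
  P `<=` Q.
Proof.
move=> [sP _ univ] sQ KQ x Px.
pose f (t x : G) : subgroup_group sQ := insubd (1 : subgroup_group sQ) x.
have fE y : Q y -> val (f y y) = y.
  by move=> Qy; rewrite insubdK //; apply: mem_set.
have [t Tt y z Kty Ktz|[phi [phiM phiE]] _] := univ (subgroup_group sQ) f.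
  have [_ QM _] := sQ; have [Qy Qz] := (KQ t Tt y Kty, KQ t Tt z Ktz).
  by apply: val_inj; rewrite gmulfM /= !fE //; apply: QM.
have [//|_ uniq_id] := univ G (fun _ y => y).
have <- : val (phi x) = x.
  apply: (uniq_id (val \o phi) id) => //= [y z Py Pz|t Tt y Kty].
    by rewrite phiM // gmulfM.
  by rewrite (phiE t) // (fE y) //; apply: KQ Kty.
exact/set_mem/valP.
Qed.


(** * The direct sum quotient of the normal closure *)

Section CohenLyndon.
Variables (G : groupType) (H : set G) (sH : subgroup H) (T : set G).
Notation N := (normal_closure H).
Notation B := (quotient_group (normal_closure_normal H)).
Notation A := (subgroup_group sH).
Notation D := (dsum (fun _ : B => A)).
Notation coset := (proj (normal_closure_normal H)).
Notation S := (coset_commutators H).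

Lemma subgroup_groupP (a : A) : H (val a).
Proof. exact/set_mem/valP. Qed.

Lemma subgroup_group_lift h : H h -> exists a : A, val a = h.
Proof.
by move=> Hh; exists (insubd (1 : A) h); rewrite insubdK //; apply: mem_set.
Qed.

Lemma closure_conj g h : H h -> N (lconj h g).
Proof.
have [_ NJ] := normal_closure_normal H.
by move=> Hh; apply: NJ; apply: normal_closure_sub.
Qed.

Lemma coset_commutatorsJ g x : S x -> S (lconj x g).
Proof.
have [_ NJ] := normal_closure_normal H.
move=> [h1 [h2 [g1 [g2 [Hh1 Hh2 g12 ->]]]]].
exists h1, h2, (g * g1), (g * g2); split=> //; last first.
  by rewrite lconjR !lconjA.
move=> /(proj_lcosetP (normal_closure_normal H)) e; apply: g12.
apply/(proj_lcosetP (normal_closure_normal H)).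
by move: e; rewrite !projM => /mulgI.
Qed.

(** The choice of representatives is the bijection of B onto T, which lets the
    factors of the free product be indexed by B. *)
Lemma transversal_section : left_transversal N T ->
  exists tr : B -> G,
    [/\ forall b, T (tr b), forall b, coset (tr b) = b
      & forall t, T t -> tr (coset t) = t].
Proof.
move=> tT; pose P b t := T t /\ coset t = b.
have cosetE g t : lcoset N g t <-> coset t = coset g.
  rewrite /lcoset; split=> [[n Nn <-]|/esym/proj_eqP Ngt].
    by rewrite projM (iffRL (proj_eq1P _ _) Nn) mulg1.
  by exists (g^-1 * t); rewrite ?mulVKg.
have [b|tr trP] := @choice _ _ P.
  have [g <-] := proj_surj b; have [t [[Tt /cosetE gt] _]] := tT g.
  by exists t.
exists tr; split=> [b|b|t Tt]; try by have [] := trP b.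
have [t' [_ t'_uniq]] := tT t.
have [Ttr tr_t] := trP (coset t).
by rewrite -(t'_uniq (tr (coset t))) ?(t'_uniq t) //; split=> //; apply/cosetE.
Qed.

Variable tr : B -> G.
Hypothesis trT : forall b, T (tr b).
Hypothesis trK : forall b, coset (tr b) = b.
Hypothesis cosetK : forall t, T t -> tr (coset t) = t.
Hypothesis fpT : free_product_of T (lconj_set H) N.

(** Maps on the factors are represented by maps on all of G in the universal
    property: insubd takes h back from t h t^-1, and is 1 outside t H t^-1. *)
Lemma component_hom : exists phi : G -> D,
  (forall x y, N x -> N y -> phi (x * y) = phi x * phi y) /\
  (forall b a, phi (lconj (val a) (tr b)) = dsum_at b a).
Proof.
have [_ _ univ] := fpT.
pose f (t x : G) : D := dsum_at (coset t) (insubd (1 : A) (lconj x t^-1)).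
have fE t (a : A) : f t (lconj (val a) t) = dsum_at (coset t) a.
  by rewrite /f lconjA mulVg /lconj mul1g invg1 mulg1 valKd.
have [t Tt _ _ [h Hh <-] [k Hk <-]|[phi [phiM phiE]] _] := univ D f.
  have [[a <-] [b <-]] := (subgroup_group_lift Hh, subgroup_group_lift Hk).
  by rewrite -lconjM -gmulfM !fE dsum_atM.
exists phi; split=> // b a; rewrite (phiE (tr b)) //.
  by rewrite fE trK.
by exists (val a) => //; apply: subgroup_groupP.
Qed.

Variable phi : G -> D.
Hypothesis phiM : forall x y, N x -> N y -> phi (x * y) = phi x * phi y.
Hypothesis phiE : forall b a, phi (lconj (val a) (tr b)) = dsum_at b a.

Let sN : subgroup N := (normal_closure_normal H).1.

Lemma phi1 : phi 1 = 1.
Proof.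
have [N1 _ _] := sN.
by apply: (mulgI (phi 1)); rewrite -phiM // !mulg1.
Qed.

Lemma phiV x : N x -> phi x^-1 = (phi x)^-1.
Proof.
have [_ _ NV] := sN.
move=> Nx; apply: (mulgI (phi x)).
by rewrite -phiM ?mulgV ?phi1 //; apply: NV.
Qed.

Lemma phiJ x g : N x -> N g -> phi (lconj x g) = lconj (phi x) (phi g).
Proof.
have [_ NM NV] := sN.
by move=> Nx Ng; rewrite /lconj !phiM ?phiV; auto.
Qed.

(** The representative of gN has the form n^-1 g with n in N, so phi sends
    g H g^-1 to a conjugate of the component of index gN. *)
Lemma phi_lconj_component g h : H h -> dsum_component (coset g) (phi (lconj h g)).
Proof.
move=> Hh; have [a <-] := subgroup_group_lift Hh.
pose n := g * (tr (coset g))^-1.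
have Nn : N n.
  apply/(proj_eq1P (normal_closure_normal H)).
  by rewrite projM projV trK mulgV.
have -> : lconj (val a) g = lconj (lconj (val a) (tr (coset g))) n.
  by rewrite lconjA mulgVK.
rewrite phiJ //; last by apply: closure_conj; apply: subgroup_groupP.
by rewrite phiE; apply/dsum_component_conj/dsum_at_component.
Qed.

Lemma coset_commutators_sub_closure : generated S `<=` N.
Proof.
have [_ NM NV] := sN.
apply: generated_sub sN _ => _ [h1 [h2 [g1 [g2 [Hh1 Hh2 _ ->]]]]].
rewrite commgEl conjgE; have := closure_conj g1 Hh1; have := closure_conj g2 Hh2.
by move=> Nx Ny; auto 6.
Qed.

Lemma phi_coset_commutators x : generated S x -> phi x = 1.
Proof.
have [N1 NM NV] := sN.
suff : generated S `<=` [set y | N y /\ phi y = 1] by move=> /[apply] -[].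
apply: generated_sub => [|_ [h1 [h2 [g1 [g2 [Hh1 Hh2 g12 ->]]]]]].
  split=> [|y z [Ny y1] [Nz z1]|y [Ny y1]] /=; first by rewrite phi1.
    by rewrite phiM // y1 z1 mulg1; split=> //; apply: NM.
  by rewrite phiV // y1 invg1; split=> //; apply: NV.
have [Nx Ny] := (closure_conj g1 Hh1, closure_conj g2 Hh2).
split.
  apply: coset_commutators_sub_closure; apply: sub_generated.
  by exists h1, h2, g1, g2.
have xyC : commute (phi (lconj h1 g1)) (phi (lconj h2 g2)).
  apply: (@dsum_component_commute _ _ (coset g1) (coset g2)).
  - by move=> /proj_lcosetP.
  - exact: phi_lconj_component.
  - exact: phi_lconj_component.
move: (lconj h1 g1) (lconj h2 g2) Nx Ny xyC => y z Ny Nz yzC.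
rewrite commgEl conjgE !phiM ?phiV; auto 6.
by rewrite yzC mulKg mulVg.
Qed.

Variable nS : normal_subgroup (generated S).
Notation W := (quotient_group nS).
Notation pi := (proj nS).

Definition component b (a : A) : G := lconj (val a) (tr b).

Lemma componentM b : {morph component b : a c / a * c}.
Proof. by move=> a c; rewrite /component gmulfM lconjM. Qed.

Lemma component_closure b a : N (component b a).
Proof. by apply: closure_conj; apply: subgroup_groupP. Qed.

Lemma pi_component_commute b c a d : b != c ->
  commute (pi (component b a)) (pi (component c d)).
Proof.
move=> bc; apply/esym; rewrite /commute -!projM; apply/proj_eqP.
apply: sub_generated; exists (val a), (val d), (tr b), (tr c).
split; try exact: subgroup_groupP.
  move=> /(proj_lcosetP (normal_closure_normal H)); rewrite !trK.
  exact/eqP.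
by rewrite commgEl conjgE invgM -!mulgA.
Qed.

Lemma pi_oprod s h :
  pi (oprod component s h) = oprod (fun b a => pi (component b a)) s h.
Proof. by rewrite /oprod; apply: (big_morph _ (projM nS) (proj1 nS)). Qed.

Lemma closure_oprod s h : N (oprod component s h).
Proof.
have [N1 NM _] := sN.
by apply: big_ind => // b _; apply: component_closure.
Qed.

Lemma phi_oprod s h : phi (oprod component s h) = oprod (@dsum_at B A) s h.
Proof.
elim: s => [|b s IHs]; first by rewrite /oprod !big_nil phi1.
rewrite /oprod !big_cons phiM; last exact: closure_oprod.
  by rewrite phiE -!/(oprod _ s h) IHs.
exact: component_closure.
Qed.

(** Modulo the commutators, the set of ordered products over duplicate-free
    lists of cosets is stable under the left multiplication by the factors of
    the free product, hence it is all of N. *)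
Lemma closure_oprod_mod x : N x ->
  exists s h, uniq s /\ pi x = pi (oprod component s h).
Proof.
pose X := [set x : G | exists b a, x = component b a].
have NX : N `<=` generated X.
  apply: free_product_generated fpT (generated_subgroup X) _ => t Tt _ [h Hh <-].
  have [a <-] := subgroup_group_lift Hh.
  by apply: sub_generated; exists (coset t), a; rewrite /component cosetK.
move=> /NX; move: x; apply: generated_left_ind => [_ [b [a ->]]||_ x [b [a ->]]].
- by exists b, a^-1; rewrite /component gmulfV lconjV.
- by exists [::], (fun=> 1); rewrite /oprod big_nil.
move=> [s [h [us xE]]].
have eM c : {morph (fun a => pi (component c a)) : a d / a * d}.
  by move=> a' d; rewrite componentM projM.
have [s' [h' [us' hE]]] := mul_oprod eM pi_component_commute h b a us.
by exists s', h'; split=> //; rewrite projM xE !pi_oprod.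
Qed.

(** On an ordered product congruent to x, phi takes the value 1 as on x, which
    forces every factor to be trivial. *)
Lemma phi_ker x : N x -> phi x = 1 -> generated S x.
Proof.
move=> Nx x1; apply/(proj_eq1P nS).
have [s [h [us xE]]] := closure_oprod_mod Nx.
have [_ _ NV] := sN.
have: generated S ((oprod component s h)^-1 * x) by apply/proj_eqP.
move=> /phi_coset_commutators.
have Np := closure_oprod s h; have NVp := NV _ Np.
rewrite phiM // phiV // x1 mulg1 phi_oprod => /(congr1 (@inv D)).
rewrite invgK invg1 => h1.
rewrite xE pi_oprod /oprod big_seq big1 // => b bs.
have -> : h b = 1 by have := oprod_dsum_at h b us; rewrite h1 bs.
by rewrite /component gmulf1 /lconj mulg1 mulgV.
Qed.

Lemma phi_eqP x y : N x -> N y -> phi x = phi y <-> pi x = pi y.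
Proof.
have [_ NM NV] := sN; move=> Nx Ny; have NVx := NV _ Nx.
split=> [xy|/proj_eqP/phi_coset_commutators].
  by apply/proj_eqP; apply: phi_ker; [apply: NM | rewrite phiM // phiV // xy mulVg].
rewrite phiM // phiV // => xy; apply: (mulgI (phi x)^-1).
by rewrite xy mulVg.
Qed.

(** A section of phi which, followed by the projection onto W, inverts the
    isomorphism from the image of N onto D induced by phi. *)
Definition lift (u : D) : G := oprod component (dsupport u) u.

Lemma closure_lift u : N (lift u).
Proof. exact: closure_oprod. Qed.

Lemma phi_lift u : phi (lift u) = u.
Proof. by rewrite phi_oprod oprod_dsupport. Qed.

Lemma pi_lift_phi x : N x -> pi (lift (phi x)) = pi x.
Proof.
by move=> Nx; apply/phi_eqP; rewrite ?phi_lift //; apply: closure_lift.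
Qed.

Lemma pi_liftM : {morph pi \o lift : u v / u * v}.
Proof.
have [_ NM _] := sN.
move=> u v /=; rewrite -projM -{1}(phi_lift u) -{1}(phi_lift v) -phiM.
- by apply: pi_lift_phi; apply: NM; apply: closure_lift.
- exact: closure_lift.
- exact: closure_lift.
Qed.

Lemma pi_lift_inj : injective (pi \o lift).
Proof.
move=> u v /phi_eqP; rewrite !phi_lift.
by apply; apply: closure_lift.
Qed.

(** The homomorphism onto B induced by coset, since <S> is contained in N. *)
Definition eps (w : W) : B := coset (repr w).

Lemma epsE g : eps (pi g) = coset g.
Proof.
apply/esym/proj_eqP; apply: coset_commutators_sub_closure.
exact/(proj_eqP nS)/esym/reprK.
Qed.

Lemma epsM : {morph eps : v w / v * w}.
Proof.
move=> v w; have [[x <-] [y <-]] := (proj_surj v, proj_surj w).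
by rewrite -projM !epsE projM.
Qed.

(** Only an inclusion: applied to w^-1 as well, it gives the equality required
    of a wreath-like product. *)
Lemma lift_component_conj w b :
  lconj_set ((pi \o lift) @` dsum_component b) w
  `<=` (pi \o lift) @` dsum_component (eps w * b).
Proof.
move=> _ [_ [u /dsum_componentE ub <-] <-]; have [g <-] := proj_surj w.
rewrite epsE; exists (phi (lconj (component b (u b)) g)).
  have -> : coset g * b = coset (g * tr b) by rewrite projM trK.
  by rewrite lconjA; apply: phi_lconj_component; apply: subgroup_groupP.
rewrite /= pi_lift_phi; last first.
  by rewrite lconjA; apply: closure_conj; apply: subgroup_groupP.
rewrite projJ; congr lconj; rewrite {2}ub -phiE pi_lift_phi //.
exact: component_closure.
Qed.

Lemma quotient_wreath_like : wreath_like A (fun b c : B => b * c) W.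
Proof.
exists (fun=> A), (multiplicative_of pi_liftM), (multiplicative_of epsM).
split; first split=> /=.
- exact: pi_lift_inj.
- apply/seteqP; split=> [_ [u _ <-]|w] /=.
    by rewrite epsE; apply/proj_eq1P; apply: closure_lift.
  have [x <-] := proj_surj w; rewrite epsE => /proj_eq1P Nx.
  by exists (phi x) => //; apply: pi_lift_phi.
- apply/seteqP; split=> // b _.
  by have [g <-] := proj_surj b; exists (pi g) => //; apply: epsE.
- by move=> b; exists idfun; exists id.
move=> w b; apply/seteqP; split=> [|v vwb]; first exact: lift_component_conj.
(* The converse inclusion is the direct one for w^-1 at the index eps w * b. *)
exists (lconj v w^-1); last exact: lconjK.
suff: lconj_set ((pi \o lift) @` dsum_component (eps w * b)) w^-1 (lconj v w^-1).
  move=> /lift_component_conj; rewrite mulgA -epsM mulVg.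
  by rewrite (_ : eps 1 = 1) ?mul1g //; apply: epsE.
by exists v.
Qed.

End CohenLyndon.

Lemma mulg_regular (B : groupType) : regular_action (fun b c : B => b * c).
Proof.
split=> [|b c /(canRL (mulgK c))||b c].
- by split=> [b|b c d]; rewrite ?mul1g ?mulgA.
- by rewrite mulgV.
- exact: (inhabits 1).
- by exists (c * b^-1); rewrite mulgVK.
Qed.

Theorem proposition2p6 (G : groupType) (H : set G) (sH : subgroup H)
    (CL : Cohen_Lyndon_subgroup H) :
  exists nS : normal_subgroup (generated (coset_commutators H)),
    regular_wreath_like (subgroup_group sH)
      (quotient_group (normal_closure_normal H))
      (quotient_group nS).
Proof.
have [_ [T [tT fpT]]] := CL.
have [tr [trT trK cosetK]] := transversal_section tT.
have [phi [phiM phiE]] := component_hom sH trT trK fpT.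
exists (generated_normal (@coset_commutatorsJ G H)).
exists (quotient_group (normal_closure_normal H)), (fun b c => b * c).
split; first exact: mulg_regular.
exact: (quotient_wreath_like trK cosetK fpT phiM phiE).
Qed.
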